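(* For every pair of positive integers $k,d$ with $k\leq d$, there exists a positive integer $c=c(d,k)$ such that for every positive integer $n$ there exists a set $S\subset [n]^{d}$ with $|S|\geq (n/2)^{d-k}$ such that no $k$-dimensional affine subspace of $\mathbb{R}^d$ contains more than $c$ elements of $S$.
   Context: $[n]^d=\{1,\dots,n\}^d\subset\mathbb{R}^d$ denotes the integer grid. *)

(* Defs.v *)
From mathcomp Require Export all_boot all_order all_algebra finmap.
From mathcomp Require Export boolp classical_sets reals.

Set Implicit Arguments.
Unset Strict Implicit.
Unset Printing Implicit Defensive.

Import Order.TTheory GRing.Theory Num.Theory.

Local Open Scope ring_scope.
Local Open Scope classical_set_scope.

Definition int_grid (R : realType) (n d : nat) : set 'rV[R]_d :=
  [set x : 'rV[R]_d | forall i : 'I_d, exists2 m : nat, (1 <= m <= n)%N & x 0 i = m%:R].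
Arguments int_grid : clear implicits.

Definition affine_subspace (R : realType) (d k : nat) (A : set 'rV[R]_d) : Prop :=
  exists (p : 'rV[R]_d) (U : {vspace 'rV[R]_d}),
    \dim U = k /\ A = [set p + u | u in [set` U]].

(* Main.v *)
Require Import Defs.
From mathcomp Require Import all_boot all_order all_algebra finmap.
From mathcomp Require Import boolp classical_sets reals.
From mathcomp Require Import zify ring lra.

(* Put c = 2d.  The key estimate is that for v in [n]^d there are only
   O(n^(kc)) c-tuples f with all f_i - v in a common k-dimensional subspace.
   Indeed the integer points of such a subspace in [-n, n]^d number
   O(n^j / (l_1 ... l_j)), where j <= k and l_1, ..., l_j are the norms of
   linearly independent integer vectors realising the successive minima; as
   these vectors determine the subspace, the tuples are at most
   O(n^(jc)) times the j-th power of the sum of |w|^(-c) over nonzero w in Z^d,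
   which converges since c = 2d.
   Colour [n]^d uniformly at random with 2 K n^k colours.  If K is large, on
   average at most half of the points start a monochromatic (c+1)-tuple lying
   in a k-flat.  Delete these points: every colour class now meets every k-flat
   in at most c points, and some 2 K of the classes together contain at least
   n^(d-k) / 2 points. *)

Set Implicit Arguments.
Unset Strict Implicit.
Unset Printing Implicit Defensive.

Import Order.TTheory GRing.Theory Num.Theory.

Local Open Scope ring_scope.

(** * Coordinates that control a subspace *)

(** Gaussian elimination with pivots of largest absolute value, by induction on [s]. Prescribing
    arbitrary values on [I] serves the induction: it lets the next vector be corrected by an element
    of the span so that it vanishes on [I]. *)
Lemma span_coords (R : realFieldType) (d : nat) (s : seq 'rV[R]_d) :
  exists I : seq 'I_d,
    [/\ (size I <= size s)%N,
        forall (w : 'rV[R]_d) (C : R), w \in <<s>>%VS -> 0 <= C ->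
          (forall i, i \in I -> `|w 0 i| <= C) ->
          forall j, `|w 0 j| <= 3 ^+ size s * C
      & forall a : 'I_d -> R, exists2 w : 'rV[R]_d,
          w \in <<s>>%VS & forall i, i \in I -> w 0 i = a i].
Proof.
elim: s => [|v s [I [sI bI cI]]].
  exists [::]; split=> //= [w C|a]; last by exists 0; rewrite ?mem0v.
  rewrite span_nil memv0 => /eqP -> C0 _ j.
  by rewrite mxE normr0 expr0 mul1r.
have [w0 w0s w0I] := cI (fun i => v 0 i).
pose u0 := v - w0.
have sub_s w : w \in <<s>>%VS -> w \in <<v :: s>>%VS.
  by move=> ws; rewrite span_cons; apply: (subvP (addvSr _ _)).
have [u00|/rV0Pn [i0 u0i0]] := eqVneq u0 0.
  have vs : v \in <<s>>%VS by move/eqP: u00; rewrite subr_eq0 => /eqP ->.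
  have eq_sp : <<v :: s>>%VS = <<s>>%VS.
    by rewrite span_cons; apply/addv_idPr; rewrite -memvE.
  exists I; rewrite eq_sp /=; split=> //; first exact: leqW.
  move=> w C ws C0 wI j; apply: le_trans (bI w C ws C0 wI j) _.
  rewrite exprS; have := exprn_ge0 (size s) (ler0n R 3).
  by move=> h; have := mulr_ge0 h C0; lra.
(* u vanishes on I and has norm 1, attained at the new coordinate i. *)
pose i := [arg max_(i > i0) `|u0 0 i|]%O.
have imax j : `|u0 0 j| <= `|u0 0 i|.
  by rewrite /i; case: arg_maxP => // l _ /(_ j isT).
have u0i : u0 0 i != 0.
  by rewrite -normr_gt0; apply: lt_le_trans (imax i0); rewrite normr_gt0.
pose u := (u0 0 i)^-1 *: u0.
have ui : u 0 i = 1 by rewrite mxE mulVf.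
have u1 j : `|u 0 j| <= 1.
  by rewrite mxE normrM normfV ler_pdivrMl ?normr_gt0 // mulr1.
have uI j : j \in I -> u 0 j = 0.
  by move=> jI; rewrite mxE [u0 0 j]mxE [(- w0) 0 j]mxE w0I // subrr mulr0.
have us : u \in <<v :: s>>%VS.
  apply/memvZ/memvB; last exact: sub_s.
  by apply: memv_span; rewrite inE eqxx.
have decomp w : w \in <<v :: s>>%VS ->
    exists t, exists2 w', w' \in <<s>>%VS & w = w' + t *: u.
  rewrite span_cons => /memv_addP [_ /vlineP [t ->]] [w1 w1s ->].
  exists (t * u0 0 i), (w1 + t *: w0); first by rewrite memvD ?memvZ.
  by rewrite scalerA mulfK // /u0 scalerBr -addrA subrKC addrC.
have addE (w' : 'rV[R]_d) t l : (w' + t *: u) 0 l = w' 0 l + t * u 0 l.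
  by rewrite !mxE.
exists (i :: I); split=> //=.
  move=> w C /decomp [t [w' w's ->]] C0 wI j.
  have w'I l : l \in I -> `|w' 0 l| <= C.
    move=> lI; have := wI l; rewrite inE lI orbT => /(_ isT).
    by rewrite addE (uI l lI) mulr0 addr0.
  have b' := bI _ _ w's C0 w'I.
  have := wI i; rewrite inE eqxx => /(_ isT).
  rewrite !addE ui mulr1 => hi.
  set D := 3 ^+ size s in b' *.
  have D1 : C <= D * C.
    by rewrite ler_peMl // exprn_ege1 // ler1n.
  (* The value of [w'] is at most [D * C], and that of [t] at most [C + D * C <= 2 * (D * C)], which
     gives the factor 3 per vector. *)
  have tb : `|t| <= C + D * C.
    have -> : t = (w' 0 i + t) - w' 0 i by rewrite addrC addKr.
    by apply: le_trans (ler_normB _ _) _; apply: lerD.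
  have : `|t * u 0 j| <= `|t| by rewrite normrM ler_piMr.
  rewrite exprS -/D; have := b' j; have := ler_normD (w' 0 j) (t * u 0 j).
  move: D1 tb; rewrite -mulrA; set X := D * C; lra.
move=> a; have [w' w's w'I] := cI a.
exists (w' + (a i - w' 0 i) *: u).
  by apply: memvD; [exact: sub_s | exact: memvZ].
move=> l; rewrite inE => /predU1P [->|lI].
  by rewrite addE ui mulr1 addrC subrK.
by rewrite addE uI // mulr0 addr0 w'I.
Qed.

(** * Cells and fibres *)

Lemma leq_same_cell (x y t m : nat) : (0 < m)%N -> (t <= x)%N -> (t <= y)%N ->
  ((x - t) %/ m = (y - t) %/ m)%N -> (x <= y + m.-1)%N.
Proof.
move=> m0 tx ty e; suff : (x - t <= y - t + m.-1)%N by lia.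
rewrite (divn_eq (x - t) m) e leq_add ?leq_trunc_div //.
by rewrite -ltnS prednK // ltn_pmod.
Qed.

Lemma leq_expn2r (m n e : nat) : (m <= n)%N -> (m ^ e <= n ^ e)%N.
Proof. by case: e => [|e] mn //; rewrite leq_exp2r. Qed.

Lemma leq_card_fibers (T U : finType) (f : T -> U) (A : {set T}) (F : nat) :
  (forall a, a \in A -> (#|[set b in A | f b == f a]%SET| <= F)%N) ->
  (#|A| <= #|U| * F)%N.
Proof.
move=> hF; rewrite -sum1_card (partition_big f predT) //= -sum_nat_const.
apply: leq_sum => u _.
case: (pickP (fun a => (a \in A) && (f a == u))) => [a /andP[aA /eqP <-]|none].
  apply: leq_trans (hF a aA); rewrite sum1_card; apply: subset_leq_card.
  by apply/fintype.subsetP => b; rewrite !inE.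
by rewrite big_pred0.
Qed.

(** * Integer points in a cube *)

(* The cube [-n, n]^d of Z^d, shifted by n so that it is a finite type. *)
Local Notation box d n := {ffun 'I_d -> 'I_(2 * n).+1}.

Definition box_val (R : realFieldType) (d n : nat) (b : box d n) : 'rV[R]_d :=
  \row_i ((b i)%:R - n%:R).

(** The sup norm of the decoded vector: one of the two truncated differences is 0 and the other is
    the distance from [b i] to [n]. *)
Definition box_norm (d n : nat) (b : box d n) : nat :=
  \max_(i < d) (b i - n + (n - b i))%N.

Definition box_ball (R : realFieldType) (d n : nat) (U : {vspace 'rV[R]_d})
    (r : nat) : {set box d n} :=
  [set b | (box_val R b \in U) && (box_norm b <= r)%N]%SET.

Lemma box_norm_leP (d n : nat) (b : box d n) (r : nat) :
  reflect (forall i, (b i <= n + r)%N /\ (n <= b i + r)%N) (box_norm b <= r)%N.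
Proof.
apply: (iffP (bigop.bigmax_leqP _ _ _)) => h i; first by have := h i isT; lia.
by move=> _; have := h i; lia.
Qed.

Lemma box_norm_le_radius (d n : nat) (b : box d n) : (box_norm b <= n)%N.
Proof. by apply/box_norm_leP => i; have := ltn_ord (b i); lia. Qed.

Lemma box_val_inj (R : realFieldType) (d n : nat) :
  injective (@box_val R d n).
Proof.
move=> a b /rowP eq_ab; apply/ffunP => i; apply/val_inj/eqP.
by have := eq_ab i; rewrite !mxE => /addIr/eqP; rewrite eqr_nat.
Qed.

Lemma box_norm_eq0 (R : realFieldType) (d n : nat) (b : box d n) :
  box_norm b = 0%N -> box_val R b = 0.
Proof.
move=> b0; have /box_norm_leP h : (box_norm b <= 0)%N by rewrite b0.
apply/rowP => i; rewrite !mxE; have [h1 h2] := h i.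
have -> : nat_of_ord (b i) = n by lia.
by rewrite subrr.
Qed.

(** The shift by [n] makes [n + a i - b i] the code of a difference. It is meaningless when the
    difference leaves the cube, which [box_subP] excludes through [l <= n]. *)
Definition box_sub (d n : nat) (a b : box d n) : box d n :=
  [ffun i => inord (n + a i - b i)].

Lemma box_subP (R : realFieldType) (d n : nat) (a b : box d n) (l : nat) :
  (l <= n)%N -> (forall i, (a i <= b i + l)%N /\ (b i <= a i + l)%N) ->
  box_val R (box_sub a b) = box_val R a - box_val R b /\
  (box_norm (box_sub a b) <= l)%N.
Proof.
move=> ln h.
have E i : nat_of_ord (box_sub a b i) = (n + a i - b i)%N.
  by rewrite ffunE inordK //; have := h i; lia.
split; last by apply/box_norm_leP => i; rewrite E; have := h i; lia.
apply/rowP => i; rewrite !mxE E natrB; last by have := h i; lia.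
by rewrite natrD; ring.
Qed.

(* Cut the r-ball of the span into cells of side m = ceil(l / 3^j) in the
   coordinates given by span_coords; two points of the same cell differ by an
   integer vector of norm < l, hence by an element of W. *)
Lemma card_box_ball_cells (R : realFieldType) (d n : nat) (s : seq 'rV[R]_d)
    (W : {vspace 'rV[R]_d}) (r l : nat) :
  (0 < l)%N -> (l <= r)%N -> (r <= n)%N ->
  (forall w : box d n, box_val R w \in <<s>>%VS -> (box_norm w < l)%N ->
     box_val R w \in W) ->
  (#|box_ball n <<s>>%VS r| * l ^ size s <=
     ((2 * 3 ^ size s + 1) * r) ^ size s * #|box_ball n W l|)%N.
Proof.
move=> l0 lr rn hW; have [I [sI bI _]] := span_coords s.
set D := (3 ^ size s)%N; have D0 : (0 < D)%N by rewrite expn_gt0.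
pose m := (l.-1 %/ D).+1; pose q := ((2 * r) %/ m)%N.
pose g (b : box d n) (i : 'I_d) : 'I_q.+1 := inord ((b i - (n - r)) %/ m).
pose f (b : box d n) := map_tuple (g b) (in_tuple I).
have lDm : (l <= D * m)%N.
  by have := ltn_ceil l.-1 D0; rewrite -/m mulnC; lia.
have mD : (D * m.-1 <= l.-1)%N by rewrite mulnC leq_trunc_div.
have fiber a : a \in box_ball n <<s>>%VS r ->
    (#|[set b in box_ball n <<s>>%VS r | f b == f a]%SET|
       <= #|box_ball n W l|)%N.
  rewrite inE => /andP [aS /box_norm_leP aN].
  have close b : b \in [set b in box_ball n <<s>>%VS r | f b == f a]%SET ->
      box_val R (box_sub b a) = box_val R b - box_val R a /\
      (box_norm (box_sub b a) <= l.-1)%N.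
    rewrite !inE => /andP [/andP [bS /box_norm_leP bN]].
    move=> /eqP/(congr1 val) /= /eq_in_map eq_g.
    apply: box_subP; first by lia.
    (* Points of one cell differ by at most [m - 1] on [I], hence by at most [D * (m - 1) <= l - 1]
       in every coordinate. *)
    have diff : forall i, i \in I ->
        `|(box_val R b - box_val R a) 0 i| <= (m.-1)%:R.
      move=> i iI; have := congr1 (@nat_of_ord _) (eq_g i iI).
      have [a1 a2] := aN i; have [b1 b2] := bN i.
      rewrite !inordK; first last.
      - by rewrite ltnS; apply: leq_div2r; lia.
      - by rewrite ltnS; apply: leq_div2r; lia.
      have m0 : (0 < m)%N by [].
      have ta : (n - r <= a i)%N by rewrite leq_subLR addnC.
      have tb : (n - r <= b i)%N by rewrite leq_subLR addnC.
      move=> hq; move: (leq_same_cell m0 tb ta hq).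
      move: (leq_same_cell m0 ta tb (esym hq)).
      rewrite !mxE opprB addrA subrK ler_norml.
      rewrite -!(ler_nat R) !natrD => h2 h1.
      by apply/andP; split; lra.
    move=> i.
    have := bI _ _ (memvB bS aS) (ler0n R m.-1) diff i.
    rewrite !mxE opprB addrA subrK -natrX -natrM.
    move: mD; rewrite -(ler_nat R) => mD' /le_trans /(_ mD').
    rewrite ler_norml => /andP [h1 h2].
    by split; rewrite -(ler_nat R) natrD; lra.
  (* Subtracting [a] embeds its fibre into the [l]-ball of [W]. *)
  apply: leq_trans (_ : (#|(fun b => box_sub b a) @:
      [set b in box_ball n <<s>>%VS r | f b == f a]%SET| <= _)%N).
    rewrite card_in_imset // => b c /close [hb _] /close [hc _] eq_bc.
    apply: (@box_val_inj R); apply: (addIr (- box_val R a)).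
    by rewrite -hb -hc eq_bc.
  apply/subset_leq_card/fintype.subsetP => _ /imsetP [b bF ->].
  have [hv hn] := close b bF; move: bF; rewrite !inE => /andP [/andP [bS _] _].
  have hl : (box_norm (box_sub b a) < l)%N by lia.
  by rewrite (ltnW hl) andbT hW // hv memvB.
have := leq_card_fibers fiber; rewrite card_tuple card_ord => hcard.
apply: leq_trans (leq_mul hcard (leqnn _)) _.
rewrite mulnAC leq_mul2r; apply/orP; right.
apply: leq_trans (leq_mul (leq_pexp2l _ sI) (leqnn _)) _ => //.
rewrite -expnMn; apply: leq_expn2r.
(* From [l <= r], [l <= D * m] and [q * m <= 2 * r] follows [(q + 1) * l <= r + 2 * D * r]. *)
rewrite mulSn -/D; apply: leq_trans (leq_add lr (leq_mul (leqnn q) lDm)) _.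
have := leq_trunc_div (2 * r) m; rewrite -/q; nia.
Qed.

(** * Successive minima and the number of integer points of a subspace *)

(* [v :: s] extends [s] by a shortest integer vector of U outside the span
   of s, so the norms along s are the successive minima of the lattice of
   integer points of U, largest first. *)
Fixpoint minima_chain (R : realFieldType) (d n : nat) (U : {vspace 'rV[R]_d})
    (s : seq (box d n)) : Prop :=
  if s is v :: s' then
    [/\ box_val R v \in U,
        box_val R v \notin <<map (@box_val R d n) s'>>%VS,
        forall w : box d n, box_val R w \in U -> (box_norm w < box_norm v)%N ->
          box_val R w \in <<map (@box_val R d n) s'>>%VS
      & minima_chain U s']
  else True.

(** Product of the constants of [card_box_ball_cells], paid once for each vector peeled off a chain
    of length [j]. *)
Fixpoint ball_const (j : nat) : nat :=
  if j is i.+1 then ((2 * 3 ^ j + 1) ^ j * ball_const i)%N else 1%N.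

Section MinimaChain.

Variables (R : realFieldType) (d n : nat) (U : {vspace 'rV[R]_d}).
Local Notation val := (@box_val R d n).
Implicit Types (s : seq (box d n)) (v w : box d n).

Lemma minima_chain_sub s : minima_chain U s -> (<<map val s>> <= U)%VS.
Proof.
elim: s => [|v s IH] /=; first by rewrite span_nil sub0v.
by move=> [vU _ _ /IH sU]; rewrite span_cons subv_add -memvE vU.
Qed.

Lemma minima_chain_dim s : minima_chain U s -> (size s <= \dim U)%N.
Proof.
move=> cs; have /eqP : free (map val s).
  elim: s cs => [|v s IH] /=; first by rewrite nil_free.
  by move=> [_ vs _ /IH fs]; rewrite free_cons vs.
by rewrite size_map => <-; exact/dimvS/minima_chain_sub.
Qed.

Lemma minima_chain_norm_gt0 s u :
  minima_chain U s -> u \in s -> (0 < box_norm u)%N.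
Proof.
elim: s => [//|v s IH] /= [_ vs _ /IH IHs]; rewrite inE => /predU1P [->|//].
rewrite lt0n; apply: contra vs => /eqP /(box_norm_eq0 R) ->.
exact: mem0v.
Qed.

(** Being outside the full span, [w] is outside the span of every tail, so it competed each time a
    vector of [s] was chosen as shortest. With [w] the next vector of the chain, this says that the
    norms decrease along the list. *)
Lemma minima_chain_norm_le s w :
  minima_chain U s -> val w \in U -> val w \notin <<map val s>>%VS ->
  all (fun u => box_norm u <= box_norm w)%N s.
Proof.
elim: s => [//|v s IH] /= [_ vs vmin cs] wU; rewrite span_cons => wvs.
have ws : val w \notin <<map val s>>%VS.
  by apply: contra wvs; exact/subvP/addvSr.
by rewrite IH // andbT leqNgt; apply: contra ws => /vmin; exact.
Qed.

Lemma minima_chain_exists :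
  exists s, minima_chain U s /\
    forall w, val w \in U -> val w \in <<map val s>>%VS.
Proof.
(* Greedy choice: after [j] rounds either the integer points of [U] are exhausted or the chain has
   length [j], and length [\dim U + 1] is impossible. *)
suff /(_ (\dim U).+1) [s [cs [//|]]] : forall j, exists s, minima_chain U s /\
    ((forall w, val w \in U -> val w \in <<map val s>>%VS) \/ size s = j).
- by exists s.
- by move=> ss; have := minima_chain_dim cs; rewrite ss ltnn.
elim=> [|j [s [cs [sU|sj]]]]; first by exists [::]; split=> //; right.
  by exists s; split=> //; left.
pose P w := (val w \in U) && (val w \notin <<map val s>>%VS).
case: (pickP P) => [w0 Pw0|none]; last first.
  exists s; split=> //; left=> w wU.
  by have := none w; rewrite /P wU => /negbFE.
case: (arg_minnP (@box_norm d n) Pw0) => v /andP [vU vs] vmin.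
exists (v :: s); split; last by right; rewrite /= sj.
split=> // w wU wv; apply: contraTT wv => ws; rewrite -leqNgt.
by apply: vmin; rewrite /P wU.
Qed.

(** An upper bound in the style of Minkowski's second theorem. With [l] the norm of the head [v],
    every shorter point of the span lies in the span of the tail, so the cell count passes from
    radius [r] to the [l]-ball of the tail. Induction bounds that ball at radius [l], and a factor
    [l ^ j] cancels. *)
Lemma card_box_ball_chain s (r : nat) :
  minima_chain U s -> all (fun u => box_norm u <= r)%N s -> (r <= n)%N ->
  (#|box_ball n <<map val s>>%VS r| * \prod_(u <- s) box_norm u
     <= ball_const (size s) * r ^ size s)%N.
Proof.
elim: s r => [|v s IH] r.
  move=> _ _ _; rewrite big_nil muln1; apply/card_le1_eqP => a b.
  rewrite !inE span_nil !memv0 => /andP [/eqP a0 _] /andP [/eqP b0 _].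
  by apply: (@box_val_inj R); rewrite a0.
move=> chain_vs /= /andP [vr sr] rn.
have := chain_vs => -[vU vs vmin cs].
have v0 : (0 < box_norm v)%N.
  by apply: minima_chain_norm_gt0 chain_vs _; rewrite inE eqxx.
have sub_vs w : val w \in <<map val (v :: s)>>%VS ->
    (box_norm w < box_norm v)%N -> val w \in <<map val s>>%VS.
  by move=> /(subvP (minima_chain_sub chain_vs)); exact: vmin.
have := card_box_ball_cells v0 vr rn sub_vs.
have := IH _ cs (minima_chain_norm_le cs vU vs) (box_norm_le_radius v).
rewrite size_map big_cons [size (v :: s)]/=.
set l := box_norm v in v0 *; set P := \prod_(u <- s) _; set j := size s.
set N := #|box_ball n <<map val (v :: s)>>%VS r|.
set M := #|box_ball n _ l|; set A := (2 * 3 ^ j.+1 + 1)%N => hM hN.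
have lj : (0 < l ^ j)%N by rewrite expn_gt0 v0.
rewrite -(leq_pmul2r lj) [ball_const _]/= -/A.
have -> : (N * (l * P) * l ^ j = N * l ^ j.+1 * P)%N by rewrite expnS; ring.
apply: leq_trans (leq_mul hN (leqnn P)) _; rewrite -mulnA expnMn.
apply: leq_trans (leq_mul (leqnn _) hM) _.
by rewrite leq_eqVlt; apply/orP; left; apply/eqP; ring.
Qed.

End MinimaChain.

(** * The sum of inverse powers of norms *)

Lemma leq_card_covered (T I : finType) (P : pred I) (E : I -> {set T})
    (Y : {set T}) :
  (forall y, y \in Y -> exists2 i, P i & y \in E i) ->
  (#|Y| <= \sum_(i | P i) #|E i|)%N.
Proof.
move=> hY; apply: leq_trans (_ : (#|\bigcup_(i | P i) E i| <= _)%N).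
  apply/subset_leq_card/fintype.subsetP => y /hY [i Pi yi].
  by apply/finset.bigcupP; exists i.
elim/big_rec2: _ => [|i m A _ IH]; first by rewrite cards0.
exact: leq_trans (leq_card_setU _ _) (leq_add (leqnn _) IH).
Qed.

(** The value at 0 is 1, so that a zero coordinate contributes a neutral factor to the product in
    [sum_box_norm]. *)
Definition inv_sq (R : realFieldType) (x : nat) : R := ((maxn 1 x)%:R^-1) ^+ 2.

(** Telescoping, from [1/(x+1)^2 <= 1/x - 1/(x+1)]. *)
Lemma sum_inv_sq_le2 (R : realFieldType) (n : nat) :
  \sum_(0 <= a < n) inv_sq R a.+1 <= 2.
Proof.
case: n => [|n]; first by rewrite big_geq.
suff h : \sum_(0 <= a < n.+1) inv_sq R a.+1 <= 2 - n.+1%:R^-1.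
  by apply: le_trans h _; rewrite lerBlDr lerDl invr_ge0.
elim: n => [|n IH]; first by rewrite big_nat1 /inv_sq invr1; lra.
rewrite big_nat_recr //=; apply: le_trans (lerD IH (lexx _)) _.
rewrite /inv_sq (maxn_idPr _) // expr2.
have p1 : 0 < n.+1%:R :> R by rewrite ltr0n.
have -> : n.+2%:R = n.+1%:R + 1 :> R by rewrite -natr1.
move: (n.+1%:R : R) p1 => x x0.
have e : x^-1 - (x + 1)^-1 = x^-1 * (x + 1)^-1 by field; lra.
have : (x + 1)^-1 * (x + 1)^-1 <= x^-1 * (x + 1)^-1.
  by rewrite ler_pM2r ?invr_gt0 ?lef_pV2 ?posrE; lra.
lra.
Qed.

(** The central term gives 1 and each side at most 2. *)
Lemma sum_inv_sq_dist (R : realFieldType) (n : nat) :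
  \sum_(a < (2 * n).+1) inv_sq R (a - n + (n - a)) <= 5.
Proof.
rewrite -(big_mkord predT (fun a => inv_sq R (a - n + (n - a)))).
rewrite (@big_cat_nat _ _ _ n) /=; [|lia|lia].
rewrite [X in _ + X]big_ltn; last by lia.
have -> : \sum_(0 <= a < n) inv_sq R (a - n + (n - a)) =
          \sum_(0 <= a < n) inv_sq R a.+1.
  rewrite big_nat_rev /=; apply: eq_big_nat => a /andP [_ an].
  by congr inv_sq; lia.
have -> : \sum_(n.+1 <= a < (2 * n).+1) inv_sq R (a - n + (n - a)) =
          \sum_(0 <= a < n) inv_sq R a.+1.
  rewrite -{1}[n.+1]add0n big_addn; have -> : ((2 * n).+1 - n.+1 = n)%N by lia.
  by apply: eq_big_nat => a _; congr inv_sq; lia.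
have := sum_inv_sq_le2 R n; rewrite subnn /inv_sq invr1; lra.
Qed.

(** The norm dominates every coordinate, so its power [-2d] is at most a product of one inverse
    square per coordinate; the sum of these products factors into [d] one-dimensional sums. *)
Lemma sum_box_norm (R : realFieldType) (d n : nat) :
  \sum_(v : box d n) ((box_norm v)%:R^-1 : R) ^+ (2 * d) <= 5 ^+ d.
Proof.
apply: le_trans (_ : \sum_(v : box d n)
    \prod_(i < d) inv_sq R (v i - n + (n - v i)) <= _).
  apply: ler_sum => v _; rewrite exprM -[X in _ ^+ X](card_ord d).
  rewrite -prodr_const; apply: ler_prod => i _; rewrite exprn_ge0 ?invr_ge0 //=.
  have hi : (v i - n + (n - v i) <= box_norm v)%N.
    have /box_norm_leP /(_ i) := leqnn (box_norm v).
    by move: (nat_of_ord (v i)) => x; lia.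
  (* The zero vector is harmless because [0^-1 = 0]. *)
  have [->|v0] := posnP (box_norm v).
    by rewrite invr0 expr0n exprn_ge0 ?invr_ge0.
  rewrite lerXn2r ?nnegrE ?invr_ge0 //.
  by rewrite lef_pV2 ?posrE ?ltr0n ?ler_nat ?leq_max // geq_max v0.
rewrite -(bigA_distr_bigA (fun (i : 'I_d) (a : 'I_(2 * n).+1) =>
  inv_sq R (a - n + (n - a)))) /=.
rewrite prodr_const card_ord lerXn2r ?nnegrE ?sum_inv_sq_dist //.
by apply: sumr_ge0 => a _; rewrite exprn_ge0 ?invr_ge0.
Qed.

(** * Counting tuples in a common subspace *)

(** Each tuple is charged to the vectors [f] of its chain, and [U] is forgotten: only [P f],
    positive norms and the point count, is kept. A given [f] receives at most [#|B f| ^ (2 * d)]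
    tuples, and the sum over [f] becomes a [j]-th power. *)
Lemma card_tuples_in_chain (R : realFieldType) (d n j : nat)
    (Y : {set {ffun 'I_(2 * d) -> box d n}}) :
  (forall y, y \in Y -> exists (U : {vspace 'rV[R]_d}) (s : seq (box d n)),
     [/\ minima_chain U s, size s = j
       & forall i, box_val R (y i) \in <<map (@box_val R d n) s>>%VS]) ->
  (#|Y| <= ball_const j ^ (2 * d) * 5 ^ (d * j) * n ^ (j * (2 * d)))%N.
Proof.
move=> hY.
pose B (f : {ffun 'I_j -> box d n}) :=
  box_ball n <<map (@box_val R d n) (codom f)>>%VS n.
pose P (f : {ffun 'I_j -> box d n}) := [forall i, 0 < box_norm (f i)]%N &&
  (#|B f| * \prod_i box_norm (f i) <= ball_const j * n ^ j)%N.
pose E f := [set y : {ffun 'I_(2 * d) -> box d n} | y \in ffun_on (mem (B f))]%SET.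
have cover y : y \in Y -> exists2 f, P f & y \in E f.
  move=> /hY [U [s [cs sj ys]]].
  pose f : {ffun 'I_j -> box d n} := [ffun i => tnth (tcast sj (in_tuple s)) i].
  have cf : codom f = s.
    transitivity (tval (tcast sj (in_tuple s))); last by rewrite val_tcast.
    by rewrite -map_tnth_enum; apply: eq_map => i; rewrite ffunE.
  exists f; last first.
    rewrite inE; apply/ffun_onP => i; rewrite inE cf ys.
    exact: box_norm_le_radius.
  apply/andP; split.
    apply/forallP => i; apply: minima_chain_norm_gt0 cs _.
    by rewrite -cf codom_f.
  have -> : (\prod_i box_norm (f i) = \prod_(u <- s) box_norm u)%N.
    by rewrite -cf big_image.
  have := card_box_ball_chain cs _ (leqnn n); rewrite /B cf sj; apply.
  by apply/allP => u _; exact: box_norm_le_radius.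
apply: leq_trans (leq_card_covered cover) _.
rewrite -(ler_nat R) natr_sum !natrM.
pose g (v : box d n) : R := (box_norm v)%:R^-1 ^+ (2 * d).
have g0 v : 0 <= g v by rewrite exprn_ge0 ?invr_ge0.
have hE f : P f -> (#|E f|%:R : R) <=
    (ball_const j * n ^ j)%:R ^+ (2 * d) * \prod_i g (f i).
  move=> /andP [/forallP f0 hf].
  rewrite cardsE card_ffun_on card_ord natrX prodrXl -exprMn.
  rewrite lerXn2r ?nnegrE // ?mulr_ge0 ?prodr_ge0 //.
    by move=> i _; rewrite invr_ge0.
  rewrite prodfV ler_pdivlMr; last by apply: prodr_gt0 => i _; rewrite ltr0n.
  by rewrite -natr_prod -natrM ler_nat.
apply: le_trans (ler_sum _ hE) _; rewrite -big_distrr /=.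
apply: le_trans (_ : (ball_const j * n ^ j)%:R ^+ (2 * d) * (5 ^+ d) ^+ j <= _).
  apply: ler_wpM2l; first by rewrite exprn_ge0.
  (* Dropping [P] adds only nonnegative terms and lets the sum factor. *)
  apply: le_trans (_ : \sum_(f : {ffun 'I_j -> box d n}) \prod_i g (f i) <= _).
    rewrite [leRHS](bigID P) /= lerDl sumr_ge0 // => f _.
    by apply: prodr_ge0.
  rewrite -(bigA_distr_bigA (fun (i : 'I_j) v => g v)) /= prodr_const card_ord.
  by rewrite lerXn2r ?nnegrE ?sum_box_norm ?sumr_ge0 ?exprn_ge0.
rewrite natrM exprMn !natrX -!exprM.
by rewrite le_eqVlt; apply/orP; left; apply/eqP; ring.
Qed.

Definition flat_const (d k : nat) : nat :=
  (\sum_(j < k.+1) ball_const j ^ (2 * d) * 5 ^ (d * j))%N.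

(** The integer points of [U] may span less than [U], so all chain lengths [j <= k] are summed;
    [n ^ j <= n ^ k] since [n] is positive. *)
Lemma card_tuples_in_subspace (R : realFieldType) (d n k : nat)
    (Y : {set {ffun 'I_(2 * d) -> box d n}}) :
  (0 < n)%N ->
  (forall y, y \in Y -> exists2 U : {vspace 'rV[R]_d},
     \dim U = k & forall i, box_val R (y i) \in U) ->
  (#|Y| <= flat_const d k * n ^ (k * (2 * d)))%N.
Proof.
move=> n0 hY.
pose Q (j : 'I_k.+1) (y : {ffun 'I_(2 * d) -> box d n}) :=
  exists (U : {vspace 'rV[R]_d}) (s : seq (box d n)),
     [/\ minima_chain U s, size s = j
       & forall i, box_val R (y i) \in <<map (@box_val R d n) s>>%VS].
pose E j := [set y | `[< Q j y >]]%SET.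
have cover y : y \in Y -> exists2 j, predT j & y \in E j.
  move=> /hY [U Uk yU]; have [s [cs hs]] := minima_chain_exists n U.
  have sk : (size s < k.+1)%N by rewrite ltnS -Uk minima_chain_dim.
  exists (Ordinal sk) => //; rewrite inE; apply/asboolP; exists U, s; split=> //.
  by move=> i; exact: hs.
apply: leq_trans (leq_card_covered cover) _; rewrite /flat_const big_distrl /=.
apply: leq_sum => j _.
apply: leq_trans (card_tuples_in_chain (R := R) (j := j) _) _.
  by move=> y; rewrite inE => /asboolP.
rewrite leq_mul2l leq_pexp2l ?orbT //.
by rewrite leq_mul2r -ltnS ltn_ord orbT.
Qed.

(** * Random colouring *)

(** Recolouring the points of [f] arbitrarily is injective on pairs of a monochromatic colouring and
    new colours: the erased colours all equal that of [v], which [f] avoids, and the new ones are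
    read off [f]. *)
Lemma card_monochromatic (V C : finType) (c : nat) (v : V)
    (f : {ffun 'I_c -> V}) :
  injective f -> (forall i, f i != v) ->
  (#|[set phi : {ffun V -> C} | [forall i, phi (f i) == phi v]]%SET| * #|C| ^ c
     <= #|C| ^ #|V|)%N.
Proof.
move=> f_inj fv.
pose mono := [set phi : {ffun V -> C} | [forall i, phi (f i) == phi v]]%SET.
pose h (p : {ffun V -> C} * {ffun 'I_c -> C}) : {ffun V -> C} :=
  [ffun x => if [pick i | f i == x] is Some i then p.2 i else p.1 x].
have h_im p i : h p (f i) = p.2 i.
  rewrite ffunE; case: pickP => [j /eqP /f_inj -> //|/(_ i)].
  by rewrite eqxx.
have h_out p x : (forall i, f i != x) -> h p x = p.1 x.
  by move=> fx; rewrite ffunE; case: pickP => // j; rewrite (negbTE (fx j)).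
have -> : (#|C| ^ c = #|[set: {ffun 'I_c -> C}]%SET|)%N.
  by rewrite cardsT card_ffun card_ord.
rewrite -/mono -card_ffun -cardsX.
rewrite -(card_in_imset (f := h)) ?max_card //.
move=> [phi g] [psi g']; rewrite !inE !andbT /=.
move=> /forallP phi_mono /forallP psi_mono eq_h.
have eq_v : phi v = psi v.
  by rewrite -(h_out (phi, g)) // -(h_out (psi, g')) // eq_h.
congr pair; apply/ffunP => x; last first.
  by rewrite -(h_im (phi, g)) -(h_im (psi, g')) eq_h.
case: (pickP (fun i => f i == x)) => [i /eqP <-|fx].
  by rewrite (eqP (phi_mono i)) (eqP (psi_mono i)).
have {}fx i : f i != x by rewrite fx.
by rewrite -(h_out (phi, g)) // -(h_out (psi, g')) // eq_h.
Qed.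

Lemma colouring_few_bad (V C : finType) (c D : nat)
    (E : V -> {set {ffun 'I_c -> V}}) :
  (0 < #|C|)%N ->
  (forall v f, f \in E v -> injective f /\ forall i, f i != v) ->
  (forall v, #|E v| <= D)%N -> (2 * D <= #|C| ^ c)%N ->
  exists phi : {ffun V -> C},
    (2 * #|[set v | [exists f in E v, [forall i, phi (f i) == phi v]]]%SET|
       <= #|V|)%N.
Proof.
move=> C0 E_inj ED DC.
pose mono (phi : {ffun V -> C}) v (f : {ffun 'I_c -> V}) :=
  [forall i, phi (f i) == phi v].
pose bad (phi : {ffun V -> C}) :=
  [set v | [exists f in E v, mono phi v f]]%SET.
case: (pickP (fun phi => 2 * #|bad phi| <= #|V|)%N) => [phi|none].
  by exists phi.
(* First moment: if every colouring had more than half of the points bad, the total over colourings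
   would exceed the union bound [few]. *)
have many : (#|V|.+1 * #|C| ^ #|V| <= \sum_phi 2 * #|bad phi|)%N.
  rewrite -card_ffun mulnC -sum_nat_const; apply: leq_sum => phi _.
  by rewrite ltnNge none.
have bad_le phi : (#|bad phi| <= \sum_v \sum_(f in E v) mono phi v f)%N.
  rewrite -sum1_card big_mkcond /=; apply: leq_sum => v _.
  rewrite inE; case: existsP => //= -[f /andP [fE fm]].
  by rewrite (bigD1 f) //= fm.
have few : (#|C| ^ c * (\sum_phi 2 * #|bad phi|)
    <= #|C| ^ c * (#|V| * #|C| ^ #|V|))%N.
  rewrite -big_distrr /=.
  apply: leq_trans (_ : (#|C| ^ c * (2 * \sum_v \sum_(f in E v)
      #|[set phi | mono phi v f]%SET|) <= _)%N).
    rewrite !leq_mul2l; apply/orP; right; apply/orP; right.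
    apply: leq_trans (leq_sum _ (fun phi _ => bad_le phi)) _.
    rewrite exchange_big /=; apply: leq_sum => v _.
    rewrite exchange_big /=; apply: leq_sum => f _.
    by rewrite -sum1_card [leqRHS]big_mkcond /=; apply: leq_sum => phi _;
       rewrite inE; case: (mono phi v f).
  apply: leq_trans (_ : (\sum_(v : V) 2 * (D * #|C| ^ #|V|) <= _)%N).
    rewrite !big_distrr /=; apply: leq_sum => v _.
    rewrite mulnCA leq_mul2l mulnC big_distrl /=.
    apply: leq_trans (_ : (\sum_(f in E v) #|C| ^ #|V| <= _)%N).
      apply: leq_sum => f fE; have [f_inj fv] := E_inj v f fE.
      exact: card_monochromatic.
    by rewrite sum_nat_const leq_mul2r ED !orbT.
  rewrite sum_nat_const [(2 * (D * _))%N]mulnA mulnCA leq_mul2r DC.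
  exact: orbT.
move: few; rewrite leq_pmul2l ?expn_gt0 ?C0 // => few.
by have := leq_trans many few; rewrite leq_pmul2r ?ltnn // expn_gt0 C0.
Qed.

(** * Construction of the set in the grid *)

Lemma flat_const_gt0 (d k : nat) : (0 < flat_const d k)%N.
Proof. by rewrite /flat_const big_ord_recl /= exp1n muln0. Qed.

Definition grid_val (R : realFieldType) (d n : nat) (a : {ffun 'I_d -> 'I_n}) :
    'rV[R]_d := \row_i (a i).+1%:R.

Lemma grid_val_inj (R : realFieldType) (d n : nat) :
  injective (@grid_val R d n).
Proof.
move=> a b /rowP eq_ab; apply/ffunP => i; apply/val_inj/eqP.
by have := eq_ab i; rewrite !mxE => /eqP; rewrite eqr_nat.
Qed.

(** Together with [v], such a tuple forms [2d + 1] distinct points of one [k]-flat, the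
    configuration that a colour class must avoid. *)
Definition flat_tuples (R : realFieldType) (d n k : nat)
    (v : {ffun 'I_d -> 'I_n}) : {set {ffun 'I_(2 * d) -> {ffun 'I_d -> 'I_n}}} :=
  [set f : {ffun 'I_(2 * d) -> {ffun 'I_d -> 'I_n}} |
    [&& injectiveb f, [forall i, f i != v]
    & `[< exists2 U : {vspace 'rV[R]_d}, \dim U = k
          & forall i, grid_val R (f i) - grid_val R v \in U >]]]%SET.

Lemma card_flat_tuples (R : realFieldType) (d n k : nat)
    (v : {ffun 'I_d -> 'I_n}) : (0 < n)%N ->
  (#|flat_tuples R k v| <= flat_const d k * n ^ (k * (2 * d)))%N.
Proof.
move=> n0.
pose diff (a : {ffun 'I_d -> 'I_n}) : box d n :=
  [ffun l => inord (n + a l - v l)].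
have diffE a : box_val R (diff a) = grid_val R a - grid_val R v.
  apply/rowP => l; rewrite !mxE ffunE inordK; last first.
    by have := ltn_ord (a l); lia.
  rewrite natrB; last by have := ltn_ord (v l); lia.
  by rewrite natrD -!natr1; ring.
pose h (f : {ffun 'I_(2 * d) -> {ffun 'I_d -> 'I_n}}) :
  {ffun 'I_(2 * d) -> box d n} := [ffun i => diff (f i)].
have h_inj : injective h.
  move=> f g /ffunP eq_fg; apply/ffunP => i; apply: (@grid_val_inj R).
  apply: (addIr (- grid_val R v)); rewrite -!diffE.
  by have := eq_fg i; rewrite !ffunE => ->.
rewrite -(card_imset _ h_inj).
apply: (card_tuples_in_subspace (R := R)) => // _ /imsetP [f fE ->].
move: fE; rewrite inE => /and3P [_ _ /asboolP [U Uk fU]].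
by exists U => // i; rewrite ffunE diffE.
Qed.

(** Otherwise [2d] points of [F] other than [v] would form a flat tuple inside [F]. *)
Lemma card_flat_avoiding (R : realFieldType) (d n k : nat)
    (U : {vspace 'rV[R]_d}) (F : {set {ffun 'I_d -> 'I_n}})
    (v : {ffun 'I_d -> 'I_n}) :
  \dim U = k -> v \in F ->
  (forall a, a \in F -> grid_val R a - grid_val R v \in U) ->
  (forall f, f \in flat_tuples R k v -> exists i, f i \notin F) ->
  (#|F| <= 2 * d)%N.
Proof.
move=> Uk vF FU avoid; rewrite leqNgt; apply/negP => big_F.
have le_c : (2 * d <= #|F :\ v|)%N by move: big_F; rewrite (cardsD1 v) vF.
pose f : {ffun 'I_(2 * d) -> {ffun 'I_d -> 'I_n}} :=
  [ffun i => enum_val (widen_ord le_c i)].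
have fF i : f i \in (F :\ v)%SET by rewrite ffunE enum_valP.
have [|i /negP []] := avoid f; last by have := fF i; rewrite !inE => /andP [].
rewrite inE; apply/and3P; split.
- apply/injectiveP => i j; rewrite !ffunE => /enum_val_inj /(congr1 val) /= e.
  exact: val_inj.
- by apply/forallP => i; have := fF i; rewrite !inE => /andP [].
- apply/asboolP; exists U => // i; apply: FU.
  by have := fF i; rewrite !inE => /andP [].
Qed.

Lemma evasive_grid_set (R : realFieldType) (d n k : nat) :
  (0 < d)%N -> (0 < n)%N ->
  exists G : {set {ffun 'I_d -> 'I_n}}, (n ^ d <= 2 * (n ^ k * #|G|))%N /\
    forall (p : 'rV[R]_d) (U : {vspace 'rV[R]_d}), \dim U = k ->
      (#|[set v in G | (grid_val R v - p)%R \in U]%SET|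
         <= 2 * flat_const d k * (2 * d))%N.
Proof.
move=> d0 n0; pose K := flat_const d k; have K0 : (0 < K)%N := flat_const_gt0 d k.
have nk0 : (0 < n ^ k)%N by rewrite expn_gt0 n0.
(* Fixing the first component of a colour selects a block of [2 * K] classes; the fullest of the
   [n ^ k] blocks has at least average size. *)
pose C := ('I_(n ^ k) * 'I_(2 * K))%type.
have cardC : #|{: C}| = (n ^ k * (2 * K))%N by rewrite card_prod !card_ord.
have [||||phi] := @colouring_few_bad {ffun 'I_d -> 'I_n} C (2 * d)
    (K * n ^ (k * (2 * d)))%N (flat_tuples R k).
- by rewrite cardC !muln_gt0 nk0 K0.
- move=> v f; rewrite inE => /and3P [/injectiveP f_inj /forallP fv _].
  by split.
- by move=> v; exact: card_flat_tuples.
(* Reduces to [2 * K <= (2 * K) ^ (2 * d)], where [d] is positive. *)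
- rewrite cardC expnMn -expnM mulnA mulnC leq_mul2l; apply/orP; right.
  by rewrite -{1}[(2 * K)%N]expn1 leq_pexp2l ?muln_gt0.
set bad := finset _ => few_bad.
pose G a := [set v | (v \notin bad) && ((phi v).1 == a)]%SET.
pose a := [arg max_(a > Ordinal nk0) #|G a|].
have amax b : (#|G b| <= #|G a|)%N.
  by rewrite /a; case: arg_maxnP => // b' _; exact.
exists (G a); split.
  have hG : (#|~: bad| <= n ^ k * #|G a|)%N.
    rewrite -{1}(card_ord (n ^ k)).
    apply: (leq_card_fibers (f := fun v => (phi v).1)) => v _.
    apply: leq_trans (amax (phi v).1); apply/subset_leq_card/fintype.subsetP.
    by move=> b; rewrite !inE.
  have := cardsC bad; move: few_bad hG; rewrite card_ffun !card_ord; lia.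
move=> p U Uk; rewrite -{1}(card_ord (2 * flat_const d k)).
apply: (leq_card_fibers (f := fun v => (phi v).2)) => v.
rewrite !inE => /andP [/andP [v_good /eqP va] vU].
apply: (card_flat_avoiding (v := v) Uk); first by rewrite !inE v_good va vU !eqxx.
  move=> b; rewrite !inE => /andP [/andP [_ bU] _].
  by rewrite -(subrKA p) -[p - _]opprB memvB.
(* A flat tuple at [v] inside the colour class of [v] would make [v] bad. *)
move=> f fE; apply/existsP; rewrite -negb_forall; apply: contra v_good.
move=> /forallP fF; apply/existsP; exists f; rewrite fE /=.
apply/forallP => i; have := fF i.
rewrite !inE => /andP [/andP [/andP [_ /eqP f1] _] /eqP f2].
by apply/eqP; rewrite [LHS]surjective_pairing [RHS]surjective_pairing f1 f2 va.
Qed.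

Local Open Scope fset_scope.
Local Open Scope classical_set_scope.

Theorem theorem1p4 (R : realType) (k d : nat) (hk : (0 < k)%N) (hd : (0 < d)%N)
    (hkd : (k <= d)%N) :
  exists c : nat, (0 < c)%N /\
    forall n : nat, (0 < n)%N ->
      exists S : {fset 'rV[R]_d},
        [/\ [set` S] `<=` int_grid R n d,
            (n%:R / 2 : R) ^+ (d - k) <= #|` S|%:R
          & forall A : set 'rV[R]_d, affine_subspace k A ->
              (#|` [fset x in S | x \in A]%fset| <= c)%N].
Proof.
exists (2 * flat_const d k * (2 * d))%N.
split; first by rewrite !muln_gt0 flat_const_gt0 hd.
move=> n n0; have [G [cardG flatG]] := evasive_grid_set R k hd n0.
pose pts (T : {set {ffun 'I_d -> 'I_n}}) := [seq grid_val R v | v <- enum T].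
have uniq_pts T : uniq (pts T).
  by rewrite map_inj_uniq ?enum_uniq //; exact: grid_val_inj.
have card_pts T : #|` [fset x in pts T]%fset| = #|T|.
  by rewrite card_fseq undup_id // size_map -cardE.
exists [fset x in pts G]%fset; split.
- move=> x /=; rewrite inE /= => /mapP [v _ ->] i; exists (v i).+1.
    by rewrite /= ltn_ord.
  by rewrite mxE.
- rewrite card_pts expr_div_n ler_pdivrMr ?exprn_gt0 // -!natrX -natrM ler_nat.
  have nk0 : (0 < n ^ k)%N by rewrite expn_gt0 n0.
  have G0 : (0 < #|G|)%N.
    have nd0 : (0 < n ^ d)%N by rewrite expn_gt0 n0.
    by have := leq_trans nd0 cardG; rewrite !muln_gt0 => /and3P [].
  (* The factor 2 lost in [cardG] is absorbed by [2 ^ (d - k)] unless [k = d]; there one point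
     suffices. *)
  have [->|m0] := posnP (d - k)%N; first by rewrite !expn0 muln1.
  rewrite -(leq_pmul2l nk0) -expnD subnKC //; apply: leq_trans cardG _.
  rewrite mulnCA leq_mul2l mulnC leq_mul2l; apply/orP; right; apply/orP; right.
  by rewrite -{1}[2%N]expn1 leq_pexp2l.
- move=> A [p [U [Uk ->]]].
  apply: leq_trans (flatG p U Uk); rewrite -card_pts.
  apply/fsubset_leq_card/fsubsetP => x.
  rewrite !inE /= => /andP [/mapP [v vG ->]]; rewrite in_setE => -[u uU eq_u].
  apply: map_f; rewrite mem_enum inE -mem_enum vG -eq_u addrC addKr.
  exact: uU.
Qed.
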